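(* Let $G^{\rm r}$ be the ring graph on $n\ge 3$ nodes, influenced by a uniformly random adversary with capability $k$, $1\le k\leq n$. For all such $k$, it holds that $\alpha^{\rm resil}(G^{\rm r},\mathrm{UR}(k))=\alpha^{\rm sus}(G^{\rm r},\mathrm{UR}(k))$. Furthermore, $$\alpha^{\rm sus}\left(G^{\rm r},\mathrm{UR}(k)\right) = \begin{cases}\frac{1}{2} & \text{if } k\in\{1,\ldots,n-1\},\\ 1 & \text{if } k=n.\end{cases}$$
   Context: Ring graph: $N=\{1,\dots,n\}$, edges $\{i,i+1\}$ with indices mod $n$. Graphical coordination game $(G,\alpha)$, $\alpha\in\mathbb{R}$: agents $N$ each choose an action in $\{x,y\}$; joint action space $\mathcal{A}=\{x,y\}^n$. The two-player payoff is $u(x,x)=1+\alpha$, $u(y,y)=1$, $u(x,y)=u(y,x)=0$. With $\mathcal{N}_i=\{j:\{i,j\}\in E\}$, $U_i(a)=\sum_{j\in\mathcal{N}_i}u(a_i,a_j)$. Write $\vec{x}=(x,\dots,x)$, $\vec{y}=(y,\dots,y)$. Adversarial influence: for an influence set $S\subseteq N$, the influenced utility is $\tilde U_i(a,S)=U_i(a)+1$ if $i\in S$ and $a_i=y$, and $\tilde U_i(a,S)=U_i(a)$ otherwise. A uniformly random adversary with capability $k$ (type $\mathrm{UR}(k)$) draws at each time $t$ the influence set $S(t)$ uniformly at random from $\{S\subseteq N:|S|=k\}$, independently across time (and of the choice of updating agent). Log-linear learning with parameter $\beta>0$: at each time $t=0,1,2,\dots$ an agent $i$ is selected uniformly at random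 from $N$; all other agents keep their actions, and agent $i$ chooses its next action to be $x$ with probability $$\frac{e^{\beta \tilde U_i((x,a_{-i}),S(t))}}{e^{\beta \tilde U_i((x,a_{-i}),S(t))}+e^{\beta \tilde U_i((y,a_{-i}),S(t))}}$$ and $y$ otherwise, where $a=a(t)$ is the current joint action. This defines an irreducible aperiodic Markov chain on $\mathcal{A}$ with unique stationary distribution $\pi_\beta$; let $\pi=\lim_{\beta\to\infty}\pi_\beta$. A joint action $a$ is strictly stochastically stable if $\pi(a)=1$. Metrics: $(G,\alpha)$ is resilient (resp. susceptible) to $\mathrm{UR}(k)$ if $\vec{x}$ (resp. $\vec{y}$) is strictly stochastically stable under the $\mathrm{UR}(k)$ adversary. $\alpha^{\rm resil}(G,\mathrm{UR}(k))=\inf\{\alpha\in\mathbb{R}: (G,\alpha)\text{ is resilient to }\mathrm{UR}(k)\}$ and $\alpha^{\rm sus}(G,\mathrm{UR}(k))=\sup\{\alpha\in\mathbb{R}: (G,\alpha)\text{ is susceptible to }\mathrm{UR}(k)\}$. *)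

(* Defs.v *)
(* MathComp-Analysis *)
From mathcomp Require Import all_boot all_order all_algebra.
From mathcomp Require Import all_classical all_reals all_analysis.
Import Order.TTheory GRing.Theory Num.Theory.
Import numFieldNormedType.Exports.

Set Implicit Arguments.
Unset Strict Implicit.
Unset Printing Implicit Defensive.

Local Open Scope classical_set_scope.
Local Open Scope ring_scope.

(* The two actions x and y are encoded as booleans. *)
Definition action := bool.
Definition actx : action := true.
Definition acty : action := false.

(* A graph on the agents V is given by its adjacency relation, and a joint
   action is a finite function from agents to actions. *)
Definition joint_action (V : finType) := {ffun V -> action}.

Definition all_x (V : finType) : joint_action V := [ffun=> actx].
Definition all_y (V : finType) : joint_action V := [ffun=> acty].

(* The joint action (s, a_{-i}). *)
Definition deviate (V : finType) (a : joint_action V) (i : V) (s : action) :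
  joint_action V := [ffun j => if j == i then s else a j].

(* On 'I_n, ordS is the cyclic successor i |-> i + 1 mod n. *)
Definition ring_graph (n : nat) : rel 'I_n :=
  fun i j => (j == ordS i) || (i == ordS j).

Definition payoff (R : realType) (alpha : R) (s t : action) : R :=
  if s == t then (if s == actx then 1 + alpha else 1) else 0.

Definition utility (R : realType) (V : finType) (e : rel V) (alpha : R)
    (i : V) (a : joint_action V) : R :=
  \sum_(j | e i j) payoff alpha (a i) (a j).

Definition influenced_utility (R : realType) (V : finType) (e : rel V)
    (alpha : R) (i : V) (a : joint_action V) (S : {set V}) : R :=
  if (i \in S) && (a i == acty) then utility e alpha i a + 1
  else utility e alpha i a.

(* Probability that the selected agent i next plays s, given the current joint
   action a and the current influence set S. *)
Definition choice_prob (R : realType) (V : finType) (e : rel V)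
    (alpha beta : R) (S : {set V}) (a : joint_action V) (i : V) (s : action)
    : R :=
  let w t := expR (beta * influenced_utility e alpha i (deviate a i t) S) in
  let px := w actx / (w actx + w acty) in
  if s == actx then px else 1 - px.

Definition influence_sets (V : finType) (k : nat) : {set {set V}} :=
  [set S : {set V} | #|S| == k]%SET.

(* One-step transition probability from a to b: the updating agent and the
   influence set are drawn uniformly and independently of each other, afresh at
   each time step, so that the process is the Markov chain with this matrix. *)
Definition transition (R : realType) (V : finType) (e : rel V)
    (alpha : R) (k : nat) (beta : R) (a b : joint_action V) : R :=
  \sum_(i : V) #|V|%:R^-1 *
    \sum_(S in influence_sets V k) #|influence_sets V k|%:R^-1 *
      \sum_(s : action | deviate a i s == b) choice_prob e alpha beta S a i s.

Definition is_stationary (R : realType) (A : finType) (P : A -> A -> R)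
    (mu : A -> R) : Prop :=
  [/\ forall a, 0 <= mu a,
      \sum_(a : A) mu a = 1 &
      forall b, \sum_(a : A) mu a * P a b = mu b].

(* The stationary distribution pi_beta. The operator get selects an element of
   the set of stationary distributions, which is a singleton when V is nonempty
   and k <= #|V|, the chain then being irreducible and aperiodic. *)
Definition stationary_dist (R : realType) (V : finType) (e : rel V)
    (alpha : R) (k : nat) (beta : R) : joint_action V -> R :=
  get [set mu | is_stationary (transition e alpha k beta) mu].

(* pi(a) = 1, where pi is the limit of pi_beta as beta tends to infinity. *)
Definition strictly_stochastically_stable (R : realType) (V : finType)
    (e : rel V) (alpha : R) (k : nat) (a : joint_action V) : Prop :=
  stationary_dist e alpha k beta a @[beta --> +oo] --> (1 : R).

Definition resilient (R : realType) (V : finType) (e : rel V) (k : nat)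
    (alpha : R) : Prop :=
  strictly_stochastically_stable e alpha k (all_x V).

Definition susceptible (R : realType) (V : finType) (e : rel V) (k : nat)
    (alpha : R) : Prop :=
  strictly_stochastically_stable e alpha k (all_y V).

(* The infimum and supremum are taken in the extended reals, where they always
   exist; a finite value thus entails that the set is nonempty and bounded on
   the relevant side. *)
Definition alpha_resil (R : realType) (V : finType) (e : rel V) (k : nat)
    : \bar R :=
  ereal_inf [set alpha%:E | alpha in [set alpha : R | resilient e k alpha]].

Definition alpha_sus (R : realType) (V : finType) (e : rel V) (k : nat)
    : \bar R :=
  ereal_sup [set alpha%:E | alpha in [set alpha : R | susceptible e k alpha]].

(* Main.v *)
(* Fix a target action r and let N(a) be the number of agents playing r in a. Along the
   chain, f(a) = \sum_(N(a) <= j < n) L^j with L large is a Foster-Lyapunov function for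
   the state "all r": at a mixed state some agent at the boundary of a block switches to r
   with probability bounded below, so f has drift at most -1; at "all not r" the drift is
   at most -c with c of order e^(-beta E), where E is the utility loss of the first agent
   switching to r; at "all r" it is at most d of order e^(-beta D), where D is the utility
   loss of the first agent leaving r. Integrating the drift against any stationary
   distribution mu gives 1 - mu(all r) <= d / c, which vanishes when D > E. On the ring,
   for r = x one gets D = 1 + 2 alpha and E = 1 + 2 threshold, and for r = y one gets
   D = 1 + 2 threshold and E = max(0, 1 + 2 alpha). *)
Require Import Defs.
From mathcomp Require Import all_boot all_order all_algebra.
From mathcomp Require Import all_classical all_reals all_analysis.
From mathcomp Require Import zify ring lra.
Import Order.TTheory GRing.Theory Num.Theory.
Import numFieldNormedType.Exports.

Set Implicit Arguments.
Unset Strict Implicit.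
Unset Printing Implicit Defensive.

Local Open Scope classical_set_scope.
Local Open Scope ring_scope.

(** * Stationary distributions and drift bounds for finite Markov chains *)

Section FiniteChain.
Variables (R : realType) (A : finType) (P : A -> A -> R).
Hypothesis P_ge0 : forall a b, 0 <= P a b.
Hypothesis P_sum1 : forall a, \sum_b P a b = 1.

(** Since the rows of [P] sum to 1, [P - 1] kills the constant column vector; it is therefore
    singular and has a nonzero left null vector as well. *)
Lemma left_fixed_vector (a0 : A) : exists2 v : A -> R,
  exists a, v a != 0 & forall b, \sum_a v a * P a b = v b.
Proof.
have A_gt0 : (0 < #|A|)%N by apply/card_gt0P; exists a0.
pose M : 'M[R]_#|A| := \matrix_(i, j) P (enum_val i) (enum_val j) - 1%:M.
have /det0P[v v_neq0 vM0] : \det M == 0.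
  rewrite -det_tr; apply/det0P; exists (const_mx 1).
    apply/negP => /eqP/matrixP/(_ ord0 (enum_rank a0)).
    by rewrite !mxE => /eqP; rewrite oner_eq0.
  apply/trmx_inj; rewrite trmx_mul trmxK; apply/matrixP => i j; rewrite !mxE.
  have := P_sum1 (enum_val i); rewrite big_enum_val/= => Pi1.
  under eq_bigr => l _ do rewrite !mxE mulr1.
  rewrite sumrB Pi1 (bigD1 i)//= eqxx big1 ?addr0 ?subrr// => l li.
  by rewrite eq_sym (negbTE li).
exists (fun a => v ord0 (enum_rank a)).
  have [i vi] := rV0Pn _ v_neq0.
  by exists (enum_val i); rewrite enum_valK.
move=> b; have /matrixP/(_ ord0 (enum_rank b)) := vM0.
rewrite /M mulmxBr mulmx1 !mxE => /subr0_eq <-; rewrite big_enum_val/=.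
by apply: eq_bigr => i _; rewrite mxE enum_valK enum_rankK.
Qed.

(* If v is a left fixed vector then |v| <= |v| P entrywise, and since P preserves the
   total mass this is an equality; so |v| can be normalised. *)
Lemma stationary_exists (a0 : A) : exists mu, is_stationary P mu.
Proof.
have [v [a va] vP] := left_fixed_vector a0.
pose Z := \sum_b `|v b|.
have Z_gt0 : 0 < Z.
  rewrite /Z (bigD1 a)//=; apply: ltr_wpDr; last by rewrite normr_gt0.
  by apply: sumr_ge0 => b _.
have gap_ge0 b : 0 <= \sum_c `|v c| * P c b - `|v b|.
  rewrite subr_ge0 -{1}vP; apply: (le_trans (ler_norm_sum _ _ _)).
  by apply: ler_sum => c _; rewrite normrM (ger0_norm (P_ge0 c b)).
have gap_sum0 : \sum_b (\sum_c `|v c| * P c b - `|v b|) = 0.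
  rewrite sumrB exchange_big/=; apply/eqP; rewrite subr_eq0; apply/eqP.
  by apply: eq_bigr => c _; rewrite -mulr_sumr P_sum1 mulr1.
exists (fun b => `|v b| / Z); split=> [b||b].
- by rewrite divr_ge0// ltW.
- by rewrite -mulr_suml divff// gt_eqF.
- under eq_bigr => c _ do rewrite mulrAC.
  rewrite -mulr_suml; congr (_ / _); apply/eqP; rewrite -subr_eq0; apply/eqP.
  by apply: (psumr_eq0P _ gap_sum0) => // c _; exact: gap_ge0.
Qed.

Lemma stationary_drift (mu f : A -> R) : is_stationary P mu ->
  \sum_a mu a * (\sum_b P a b * f b - f a) = 0.
Proof.
move=> [_ _ muP]; under eq_bigr => a _ do rewrite mulrBr mulr_sumr.
rewrite sumrB exchange_big/=; apply/eqP; rewrite subr_eq0; apply/eqP.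
apply: eq_bigr => b _; rewrite -(muP b) mulr_suml.
by apply: eq_bigr => a _; rewrite mulrA.
Qed.

(** The [mu]-average of the drift is zero, yet it is at most [mu a0 * d - (1 - mu a0) * c];
    [mu a0 <= 1] then bounds the mass off [a0]. *)
Lemma foster_lyapunov (mu f : A -> R) (a0 : A) (c d : R) :
    is_stationary P mu -> 0 < c -> 0 <= d ->
    (forall a, a != a0 -> \sum_b P a b * f b - f a <= - c) ->
    \sum_b P a0 b * f b - f a0 <= d ->
  1 - mu a0 <= d / c.
Proof.
move=> st c_gt0 d_ge0 drift drift0; have [mu_ge0 mu1 _] := st.
have mu_le1 : mu a0 <= 1 by rewrite -mu1 (bigD1 a0)//= lerDl sumr_ge0.
rewrite ler_pdivlMr// -subr_ge0 -(stationary_drift f st) (bigD1 a0)//=.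
have -> : d - (1 - mu a0) * c = d + \sum_(a | a != a0) mu a * - c.
  by rewrite -mulr_suml -mu1 (bigD1 a0)//= addrAC subrr add0r mulrN.
apply: lerD; last first.
  by apply: ler_sum => a aa0; rewrite ler_wpM2l ?mu_ge0 ?drift.
apply: le_trans (ler_wpM2l (mu_ge0 a0) drift0) _.
by rewrite ler_piMl.
Qed.

End FiniteChain.

(** * Log-linear learning with random influence sets *)

Section LogLinearLearning.
Variables (R : realType) (V : finType) (e : rel V) (alpha : R) (k : nat).

Definition revision_prob (beta : R) (a : joint_action V) (i : V) (s : action) : R :=
  \sum_(S in influence_sets V k) #|influence_sets V k|%:R^-1 *
    choice_prob e alpha beta S a i s.

Definition advantage (S : {set V}) (a : joint_action V) (i : V) (s : action) : R :=
  influenced_utility e alpha i (deviate a i s) S -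
  influenced_utility e alpha i (deviate a i (~~ s)) S.

(** The logistic form treats both actions alike, so that the targets x and y can share one
    argument. *)
Lemma choice_probE beta S a i s :
  choice_prob e alpha beta S a i s = (1 + expR (- beta * advantage S a i s))^-1.
Proof.
rewrite /choice_prob /advantage /actx /acty.
set u := fun t => influenced_utility e alpha i (deviate a i t) S.
rewrite -/(u true) -/(u false) -/(u s) -/(u (~~ s)).
have gt0 t : 0 < expR (beta * u t) := expR_gt0 _.
have -> : 1 + expR (- beta * (u s - u (~~ s))) =
    (expR (beta * u s) + expR (beta * u (~~ s))) / expR (beta * u s).
  rewrite mulrDl divff ?gt_eqF// -expRN -expRD; congr (_ + expR _); ring.
rewrite invf_div; case: s => //=.
have sum_neq0 : expR (beta * u true) + expR (beta * u false) != 0.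
  by rewrite gt_eqF// addr_gt0.
by rewrite [in RHS]addrC; field.
Qed.

Lemma choice_prob_ge0 beta S a i s : 0 <= choice_prob e alpha beta S a i s.
Proof. by rewrite choice_probE invr_ge0 addr_ge0// expR_ge0. Qed.

Lemma choice_prob_sum1 beta S a i : \sum_s choice_prob e alpha beta S a i s = 1.
Proof. by rewrite big_bool /choice_prob/= addrC subrK. Qed.

(** Both terms of the logistic denominator are at most [expR (beta * E)]; for the term 1 this uses
    [0 <= E]. *)
Lemma choice_prob_ge beta S a i s E : 0 <= beta -> 0 <= E ->
  - E <= advantage S a i s ->
  expR (- beta * E) / 2 <= choice_prob e alpha beta S a i s.
Proof.
move=> b0 E0 adv; rewrite choice_probE mulNr expRN -invfM lef_pV2; last 2 first.
- by rewrite posrE mulr_gt0// expR_gt0.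
- by rewrite posrE addr_gt0// expR_gt0.
rewrite mulr_natr mulr2n lerD//.
  by rewrite -expR0 ler_expR mulr_ge0.
by rewrite ler_expR mulNr -mulrN ler_wpM2l// lerNl.
Qed.

Lemma choice_prob_le beta S a i s D : 0 <= beta ->
  advantage S a i s <= - D ->
  choice_prob e alpha beta S a i s <= expR (- beta * D).
Proof.
move=> b0 adv; rewrite choice_probE [- beta * D]mulNr expRN lef_pV2; last 2 first.
- by rewrite posrE addr_gt0// expR_gt0.
- by rewrite posrE expR_gt0.
rewrite -[leLHS]add0r lerD// ler_expR mulNr -mulrN ler_wpM2l//.
by rewrite lerNr.
Qed.

Hypothesis k_le : (k <= #|V|)%N.

Lemma card_influence_sets_gt0 : (0 < #|influence_sets V k|)%N.
Proof.
have := cards_draws [set: V]%SET k.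
rewrite (_ : [set _ | _]%SET = influence_sets V k) => [->|].
  by rewrite cardsT bin_gt0.
by apply/setP => S; rewrite !inE finset.subsetT.
Qed.

Let influence_weight_neq0 : #|influence_sets V k|%:R != 0 :> R.
Proof. by rewrite pnatr_eq0 -lt0n card_influence_sets_gt0. Qed.

Lemma revision_prob_ge0 beta a i s : 0 <= revision_prob beta a i s.
Proof.
by apply: sumr_ge0 => S _; rewrite mulr_ge0 ?invr_ge0 ?ler0n ?choice_prob_ge0.
Qed.

Lemma revision_prob_sum1 beta a i : \sum_s revision_prob beta a i s = 1.
Proof.
rewrite exchange_big/=.
under eq_bigr => S _ do rewrite -mulr_sumr choice_prob_sum1 mulr1.
by rewrite sumr_const -[LHS]mulr_natr mulVf.
Qed.

Lemma revision_prob_le1 beta a i s : revision_prob beta a i s <= 1.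
Proof.
by rewrite -(revision_prob_sum1 beta a i) (bigD1 s)//= lerDl sumr_ge0// => t _;
  exact: revision_prob_ge0.
Qed.

(** One favourable influence set suffices for a lower bound, at the cost of a factor independent of
    [beta]. *)
Lemma revision_prob_ge beta S a i s c : S \in influence_sets V k ->
  c <= choice_prob e alpha beta S a i s ->
  #|influence_sets V k|%:R^-1 * c <= revision_prob beta a i s.
Proof.
move=> SI cS; rewrite /revision_prob (bigD1 S)//=.
apply: ler_wpDr; last by rewrite ler_wpM2l// invr_ge0.
by apply: sumr_ge0 => T _; rewrite mulr_ge0 ?invr_ge0 ?ler0n ?choice_prob_ge0.
Qed.

Lemma revision_prob_le beta a i s d :
  (forall S, S \in influence_sets V k -> choice_prob e alpha beta S a i s <= d) ->
  revision_prob beta a i s <= d.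
Proof.
move=> le_d; have -> : d = \sum_(S in influence_sets V k)
    #|influence_sets V k|%:R^-1 * d.
  by rewrite sumr_const -[RHS]mulr_natl mulrA mulfV// mul1r.
by apply: ler_sum => S SI; rewrite ler_wpM2l ?invr_ge0 ?le_d.
Qed.

Lemma transitionE beta a b : transition e alpha k beta a b =
  \sum_i #|V|%:R^-1 * \sum_(s | deviate a i s == b) revision_prob beta a i s.
Proof.
apply: eq_bigr => i _; congr (_ * _); rewrite exchange_big/=.
by apply: eq_bigr => S _; rewrite mulr_sumr.
Qed.

Lemma transition_ge0 beta a b : 0 <= transition e alpha k beta a b.
Proof.
rewrite transitionE; apply: sumr_ge0 => i _; rewrite mulr_ge0 ?invr_ge0//.
by apply: sumr_ge0 => s _; exact: revision_prob_ge0.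
Qed.

Lemma transition_expectation beta a (f : joint_action V -> R) :
  \sum_b transition e alpha k beta a b * f b =
  #|V|%:R^-1 * \sum_i \sum_s revision_prob beta a i s * f (deviate a i s).
Proof.
under eq_bigr => b _ do rewrite transitionE mulr_suml.
rewrite exchange_big mulr_sumr; apply: eq_bigr => i _ /=.
under eq_bigr => b _ do rewrite -mulrA mulr_suml big_mkcond/=.
rewrite -mulr_sumr exchange_big/=; congr (_ * _); apply: eq_bigr => s _.
rewrite (bigD1 (deviate a i s))//= eqxx big1 ?addr0// => b.
by rewrite eq_sym => /negbTE ->.
Qed.

Hypothesis V_gt0 : (0 < #|V|)%N.

Let card_neq0 : #|V|%:R != 0 :> R.
Proof. by rewrite pnatr_eq0 -lt0n. Qed.

Lemma transition_sum1 beta a : \sum_b transition e alpha k beta a b = 1.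
Proof.
have := transition_expectation beta a (fun=> 1).
under eq_bigr do rewrite mulr1; move=> ->.
under eq_bigr => i _.
  under eq_bigr do rewrite mulr1.
  rewrite revision_prob_sum1; over.
by rewrite sumr_const mulVf.
Qed.

Lemma stationary_distP beta :
  is_stationary (transition e alpha k beta) (stationary_dist e alpha k beta).
Proof.
apply: (@getPex _ [set mu | is_stationary (transition e alpha k beta) mu]).
exact: stationary_exists (transition_ge0 beta) (transition_sum1 beta) (all_x V).
Qed.

Lemma deviate_id (a : joint_action V) i : deviate a i (a i) = a.
Proof. by apply/ffunP => j; rewrite ffunE; case: eqP => [->|]. Qed.

(** An agent that keeps its action leaves [f] unchanged, so only switches contribute. *)
Lemma transition_drift beta a (f : joint_action V -> R) :
  \sum_b transition e alpha k beta a b * f b - f a =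
  #|V|%:R^-1 * \sum_i revision_prob beta a i (~~ a i) *
                       (f (deviate a i (~~ a i)) - f a).
Proof.
rewrite transition_expectation.
have {1}-> : f a = #|V|%:R^-1 * \sum_(i : V) f a.
  by rewrite sumr_const -[f a *+ _]mulr_natl mulrA mulVf// mul1r.
rewrite -mulrBr -sumrB; congr (_ * _); apply: eq_bigr => i _.
have two_actions (F : action -> R) : \sum_s F s = F (a i) + F (~~ a i).
  by rewrite big_bool; case: (a i) => //=; rewrite addrC.
have {1}-> : f a = (\sum_s revision_prob beta a i s) * f a.
  by rewrite revision_prob_sum1 mul1r.
rewrite !two_actions deviate_id; ring.
Qed.

(** * Drift of the shortfall and the stability criterion *)

Definition supporters (r : action) (a : joint_action V) : {set V} :=
  [set i | a i == r]%SET.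

Lemma card_supporters_deviate r (a : joint_action V) i : a i != r ->
  #|supporters r (deviate a i r)| = #|supporters r a|.+1.
Proof.
move=> air; have -> : supporters r (deviate a i r) = (i |: supporters r a)%SET.
  by apply/setP => j; rewrite !inE ffunE; case: (j == i); rewrite ?eqxx.
by rewrite cardsU1 inE air.
Qed.

Lemma card_supporters_deviateN r (a : joint_action V) i : a i = r ->
  #|supporters r a| = #|supporters r (deviate a i (~~ r))|.+1.
Proof.
move=> air; rewrite -(card_supporters_deviate (i := i)); last first.
  by rewrite ffunE eqxx; case: (r).
congr (#|supporters r _|); apply/ffunP => j; rewrite !ffunE.
by case: eqVneq => // ->.
Qed.

(* Lyapunov function: gaining a supporter of r when there are N of them lowers it by
   L ^+ N, losing one raises it by L ^+ N.-1. *)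
Definition shortfall (r : action) (L : R) (a : joint_action V) : R :=
  \sum_(#|supporters r a| <= j < #|V|) L ^+ j.

Lemma shortfall_deviate r L (a : joint_action V) i : a i != r ->
  shortfall r L (deviate a i r) - shortfall r L a = - L ^+ #|supporters r a|.
Proof.
move=> air; have := max_card (mem (supporters r (deviate a i r))).
rewrite /shortfall card_supporters_deviate// => lt_n.
by rewrite [X in _ - X]big_ltn// opprD addrCA subrr addr0.
Qed.

Lemma shortfall_drift r L beta a :
  \sum_b transition e alpha k beta a b * shortfall r L b - shortfall r L a =
  #|V|%:R^-1 *
    (\sum_(i | a i == r) revision_prob beta a i (~~ r) * L ^+ #|supporters r a|.-1 -
     \sum_(i | a i != r) revision_prob beta a i r * L ^+ #|supporters r a|).
Proof.
rewrite transition_drift (bigID (fun i => a i == r))/=; congr (_ * (_ + _)).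
  apply: eq_bigr => i /eqP air; rewrite air (card_supporters_deviateN air)/=.
  (* Here [a] is seen as the result of [i] returning to [r], so that a loss is the opposite of a
     gain. *)
  have := @shortfall_deviate r L (deviate a i (~~ r)) i.
  have -> : deviate (deviate a i (~~ r)) i r = a.
    by apply/ffunP => j; rewrite !ffunE; case: eqVneq => // ->.
  rewrite ffunE eqxx => /(_ _)/(congr1 -%R); rewrite opprB opprK => -> //.
  by case: (r).
rewrite -[RHS]sumrN; apply: eq_bigr => i air.
have -> : ~~ a i = r by move: air; case: (a i); case: (r).
by rewrite shortfall_deviate// mulrN.
Qed.

Lemma cvg_expR_decay (C x : R) : 0 < x ->
  1 - C * expR (- beta * x) @[beta --> +oo] --> (1 : R).
Proof.
move=> x_gt0; rewrite -[X in _ --> X]subr0 -[X in _ --> _ - X](mulr0 C).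
apply: cvgB; first exact: cvg_cst.
apply: cvgM; first exact: cvg_cst.
under eq_fun do rewrite mulNr.
apply: (cvg_comp _ _ _ (@cvgr_expR R)).
exact: gt0_cvgMly x_gt0 cvg_id.
Qed.

(* The base L of the shortfall is so large that, at a mixed state, a single agent
   switching to r with probability bounded below outweighs all possible losses. *)
Lemma strictly_stable_of_advantages (r : action) (E D : R) :
    0 <= E -> E < D ->
    (forall a, a != [ffun=> r] -> a != [ffun=> ~~ r] ->
       exists i S, [/\ S \in influence_sets V k, a i != r & 0 <= advantage S a i r]) ->
    (exists i S, S \in influence_sets V k /\ - E <= advantage S [ffun=> ~~ r] i r) ->
    (forall i S, S \in influence_sets V k -> advantage S [ffun=> r] i (~~ r) <= - D) ->
  strictly_stochastically_stable e alpha k [ffun=> r].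
Proof.
move=> E_ge0 ltED mixed opposite target.
set m : R := #|V|%:R; set q : R := #|influence_sets V k|%:R.
have m_ge1 : 1 <= m by rewrite /m ler1n.
have q_ge1 : 1 <= q by rewrite /q ler1n card_influence_sets_gt0.
have m_gt0 : 0 < m by lra.
have q_gt0 : 0 < q by lra.
(* At a mixed state with [N] supporters the gain is at least [L ^+ N / (2 * q) = 2 * m * L ^+ N.-1],
   twice the largest possible loss [m * L ^+ N.-1]. *)
pose L : R := 4 * m * q.
have L_ge1 : 1 <= L by rewrite /L; nra.
have L_gt0 : 0 < L by lra.
have Lpow_gt0 j : 0 < L ^+ j by rewrite exprn_gt0.
(* The ratio [d / c] for [d = L ^+ #|V|.-1 * expR (- beta * D)] and
   [c = expR (- beta * E) / (2 * m * q)] is [C * expR (- beta * (D - E))]. *)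
pose C : R := L ^+ #|V|.-1 * (2 * m * q).
apply: (@squeeze_cvgr _ _ _ _ (fun beta => 1 - C * expR (- beta * (D - E)))
  (fun=> 1)); last 2 first.
- by apply: cvg_expR_decay; rewrite subr_gt0.
- exact: cvg_cst.
near=> beta.
have beta_ge0 : 0 <= beta by near: beta; exact: nbhs_pinfty_ge.
have st := stationary_distP beta.
apply/andP; split; last first.
  have [mu_ge0 <- _] := st.
  by rewrite (bigD1 [ffun=> r])//= lerDl sumr_ge0.
rewrite lerBlDr -lerBlDl.
have -> : C * expR (- beta * (D - E)) =
    L ^+ #|V|.-1 * expR (- beta * D) / (m^-1 * (q^-1 * (expR (- beta * E) / 2))).
  rewrite mulrBr expRB /C; field.
  by rewrite !gt_eqF// expR_gt0.
have expE_gt0 := expR_gt0 (- beta * E).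
have c_gt0 : 0 < m^-1 * (q^-1 * (expR (- beta * E) / 2)).
  by rewrite !mulr_gt0// invr_gt0.
apply: (foster_lyapunov (f := shortfall r L) st) => //.
- by rewrite mulr_ge0 ?expR_ge0// ltW.
- move=> a ar; rewrite shortfall_drift -mulrN ler_pM2l ?invr_gt0//.
  have [a_opp|aNr] := eqVneq a [ffun=> ~~ r].
    have [i [S [SI adv]]] := opposite.
    have N0 : #|supporters r a| = 0%N.
      by apply: eq_card0 => j; rewrite !inE a_opp ffunE; case: (r).
    have air j : a j != r by rewrite a_opp ffunE; case: (r).
    rewrite N0 big1 ?sub0r ?lerN2 => [|j]; last by rewrite (negbTE (air j)).
    rewrite (bigD1 i)//= expr0 mulr1 ler_wpDr//.
      by apply: sumr_ge0 => j _; rewrite mulr1 revision_prob_ge0.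
    by apply: (revision_prob_ge SI); rewrite a_opp; exact: choice_prob_ge.
  have [i [S [SI air adv]]] := mixed a ar aNr.
  have N_gt0 : (0 < #|supporters r a|)%N.
    rewrite card_gt0; apply: contra_neq aNr => /setP supp0.
    apply/ffunP => j; have := supp0 j; rewrite !inE ffunE.
    by case: (a j); case: (r).
  set N := #|supporters r a| in N_gt0 *.
  (* A nonnegative advantage gives probability at least 1/2 under [S], which is drawn with
     probability [q^-1]. *)
  have up_ge : q^-1 * 2^-1 <= revision_prob beta a i r.
    apply: (revision_prob_ge SI); have := choice_prob_ge beta_ge0 (lexx 0).
    by move=> /(_ S a i r); rewrite oppr0 mulr0 expR0 mul1r; exact.
  have up : q^-1 * 2^-1 * L ^+ N <=
      \sum_(j | a j != r) revision_prob beta a j r * L ^+ N.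
    rewrite (bigD1 i)//= ler_wpDr//; last by rewrite ler_pM2r.
    by apply: sumr_ge0 => j _; rewrite mulr_ge0 ?revision_prob_ge0// ltW.
  have down : \sum_(j | a j == r) revision_prob beta a j (~~ r) * L ^+ N.-1 <=
      m * L ^+ N.-1.
    rewrite -mulr_suml ler_pM2r// /m -sum1_card natr_sum big_mkcond.
    by apply: ler_sum => j _; case: ifP; rewrite ?revision_prob_le1.
  apply: le_trans (lerB down up) _.
  rewrite -(prednK N_gt0)/= exprS.
  have -> : q^-1 / 2 * (L * L ^+ N.-1) = 2 * m * L ^+ N.-1.
    by rewrite /L; field; rewrite gt_eqF.
  have Lpow_ge1 : 1 <= L ^+ N.-1 by rewrite exprn_ege1.
  have expE_le1 : expR (- beta * E) <= 1.
    by rewrite -expR0 ler_expR mulNr oppr_le0 mulr_ge0.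
  have : q^-1 * (expR (- beta * E) / 2) <= 1.
    by rewrite ler_pdivrMl//; lra.
  nra.
rewrite shortfall_drift.
have suppT : #|supporters r [ffun=> r]| = #|V|.
  by apply: eq_card => j; rewrite !inE ffunE eqxx.
rewrite ler_pdivrMl// suppT lerBlDr ler_wpDr//.
  by apply: sumr_ge0 => j; rewrite ffunE eqxx.
(* At the target any of the [m] agents may leave; their number cancels the selection probability
   [m^-1]. *)
apply: (@le_trans _ _ (\sum_(i : V) expR (- beta * D) * L ^+ #|V|.-1)).
  rewrite big_mkcond; apply: ler_sum => i _; rewrite ffunE eqxx ler_pM2r//.
  by apply: revision_prob_le => S SI; apply: choice_prob_le => //; exact: target.
by rewrite sumr_const -[leLHS]mulr_natl [X in _ * X <= _]mulrC.
Unshelve. all: by end_near.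
Qed.
End LogLinearLearning.

(** * Influence sets that contain or avoid a given agent *)

Lemma influence_set_containing (V : finType) (k : nat) (i : V) :
  (0 < k <= #|V|)%N -> exists2 S, S \in influence_sets V k & i \in S.
Proof.
move=> /andP[k_gt0 k_le].
have : (0 < #|[set A : {set V} | A \subset [set~ i]%SET & #|A| == k.-1]%SET|)%N.
  by rewrite cards_draws bin_gt0 cardsC1 -!subn1 leq_sub2r.
move=> /card_gt0P[A]; rewrite inE => /andP[Ai /eqP Ak].
exists (i |: A)%SET; last by rewrite setU11.
rewrite inE cardsU1 Ak; suff -> : i \notin A by rewrite add1n prednK.
by apply/negP => /(fintype.subsetP Ai); rewrite !inE eqxx.
Qed.

Lemma influence_set_avoiding (V : finType) (k : nat) (i : V) :
  (k < #|V|)%N -> exists2 S, S \in influence_sets V k & i \notin S.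
Proof.
move=> k_lt.
have : (0 < #|[set A : {set V} | A \subset [set~ i]%SET & #|A| == k]%SET|)%N.
  by rewrite cards_draws bin_gt0 cardsC1; case: #|V| k_lt.
move=> /card_gt0P[A]; rewrite inE => /andP[Ai Ak]; exists A; first by rewrite inE.
by apply/negP => /(fintype.subsetP Ai); rewrite !inE eqxx.
Qed.

Lemma influence_sets_full (V : finType) : influence_sets V #|V| = [set [set: V]]%SET.
Proof.
by apply/setP => S; rewrite !inE eqEcard finset.subsetT cardsT/= eqn_leq max_card.
Qed.

(** * Neighbours, advantages and interfaces on the ring *)

Section Ring.
Variables (R : realType) (n : nat).
Hypothesis n_ge3 : (3 <= n)%N.

Lemma ordS_neq (i : 'I_n) : ordS i != i.
Proof.
apply/eqP => /(congr1 val)/=; have i_lt := ltn_ord i.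
have [lt_n|le_n] := ltnP i.+1 n; first by rewrite modn_small//; lia.
by rewrite (_ : i.+1 = n) ?modnn; lia.
Qed.

(** With two nodes the neighbours would coincide, and the utility would have one term instead of
    two. *)
Lemma ordS_neq_ord_pred (i : 'I_n) : ordS i != ord_pred i.
Proof.
rewrite -(inj_eq (@ordS_inj n)) ord_predK; apply/eqP => /(congr1 val)/=.
have i_lt := ltn_ord i.
have [lt1|] := ltnP i.+1 n; last first.
  move=> le_n; have -> : i.+1 = n by lia.
  by rewrite modnn modn_small; lia.
rewrite (modn_small lt1); have [lt2|le2] := ltnP i.+2 n.
  by rewrite modn_small//; lia.
have -> : i.+2 = n by lia.
by rewrite modnn; lia.
Qed.

Lemma ord_pred_neq (i : 'I_n) : ord_pred i != i.
Proof. by rewrite -(inj_eq (@ordS_inj n)) ord_predK eq_sym ordS_neq. Qed.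

Lemma ring_utility (alpha : R) i (a : joint_action 'I_n) :
  utility (@ring_graph n) alpha i a =
  payoff alpha (a i) (a (ordS i)) + payoff alpha (a i) (a (ord_pred i)).
Proof.
have edge j : ring_graph i j = (j == ordS i) || (j == ord_pred i).
  rewrite /ring_graph -[i == ordS j](inj_eq (@ord_pred_inj n)) ordSK.
  by rewrite (eq_sym j (ord_pred i)).
rewrite /utility (bigD1 (ordS i))/= ?edge ?eqxx//; congr (_ + _).
rewrite (big_pred1 (ord_pred i))// => j; rewrite edge/=.
by case: eqVneq => [->|_]/=; rewrite ?andbT ?(negbTE (ordS_neq_ord_pred i)).
Qed.

(** The last term is the adversary's bonus for y, which counts against x. *)
Lemma ring_advantage (alpha : R) (S : {set 'I_n}) (a : joint_action 'I_n) i s :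
  advantage (@ring_graph n) alpha S a i s =
    payoff alpha s (a (ordS i)) + payoff alpha s (a (ord_pred i)) -
    payoff alpha (~~ s) (a (ordS i)) - payoff alpha (~~ s) (a (ord_pred i)) +
    (if i \in S then (if s == actx then -1 else 1) else 0).
Proof.
rewrite /advantage /influenced_utility !ring_utility !ffunE !eqxx.
rewrite (negbTE (ordS_neq i)) (negbTE (ord_pred_neq i)).
by rewrite /actx /acty; case: (i \in S); case: s => /=; ring.
Qed.

Lemma ring_const (a : joint_action 'I_n) :
  (forall i, a (ordS i) = a i) -> exists t, a = [ffun=> t].
Proof.
move=> aS; have n_gt0 : (0 < n)%N by lia.
exists (a (Ordinal n_gt0)); apply/ffunP => -[j j_lt]; rewrite ffunE.
elim: j j_lt => [|j IH] j_lt; first by congr (a _); exact: val_inj.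
have j_lt' : (j < n)%N by lia.
rewrite -(IH j_lt') -(aS (Ordinal j_lt')); congr (a _).
by apply: val_inj; rewrite /= modn_small.
Qed.

(** A nonconstant [a] changes along some edge from [i] to [ordS i]; the endpoint not playing [r] is
    the witness. *)
Lemma ring_interface (a : joint_action 'I_n) (r : action) :
  a != [ffun=> r] -> a != [ffun=> ~~ r] ->
  exists i, a i != r /\ ((a (ordS i) == r) || (a (ord_pred i) == r)).
Proof.
move=> ar aNr.
have [/forallP aS|] := boolP [forall i, a (ordS i) == a i].
  have [t at_] := ring_const (fun i => eqP (aS i)).
  by move: ar aNr; rewrite at_; case: t {at_}; case: r; rewrite eqxx.
rewrite negb_forall => /existsP[i aSi].
have [air|air] := eqVneq (a i) r.
  exists (ordS i); rewrite ordSK air eqxx orbT; split=> //.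
  by rewrite -air.
by exists i; split=> //; move: aSi air {ar aNr}; case: (a (ordS i)); case: (a i); case: r.
Qed.

(** * Resilience and susceptibility on either side of the threshold *)

Variable k : nat.
Hypothesis k_range : (1 <= k <= n)%N.

(** Chosen so that [1 + 2 * threshold] is the smallest loss of the first agent leaving [all_y]: two
    edges of payoff 1, plus the bonus 1 if [k = n], when no influence set avoids the agent. *)
Definition threshold : R := if (k < n)%N then 1 / 2 else 1.

Let k_le : (k <= #|'I_n|)%N. Proof. by rewrite card_ord; case/andP: k_range. Qed.
Let n_gt0 : (0 < #|'I_n|)%N. Proof. by rewrite card_ord; lia. Qed.

Lemma ring_resilient (alpha : R) : threshold < alpha ->
  resilient (@ring_graph n) k alpha.
Proof.
move=> lt_alpha.
have thr_ge : 1 / 2 <= threshold by rewrite /threshold; case: ifP; lra.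
(* The set most favourable to x at [i]: it avoids [i] when [k < n], and is the full set when
   [k = n]. *)
have weak i : exists2 S, S \in influence_sets 'I_n k &
    forall x : R, (if i \in S then -1 else x) = (if (k < n)%N then x else -1).
  case: (ltnP k n) => [k_lt|k_ge].
    have [|S SI iS] := @influence_set_avoiding 'I_n k i; first by rewrite card_ord.
    by exists S => // x; rewrite (negbTE iS).
  have -> : k = #|'I_n| by rewrite card_ord; lia.
  by exists [set: 'I_n]%SET => [|x]; rewrite ?influence_sets_full !inE.
(* Leaving [all_x] costs two edges of payoff [1 + alpha] and earns a bonus of at most 1, whence
   [D = 1 + 2 * alpha]. *)
apply: (@strictly_stable_of_advantages _ _ _ _ _ k_le n_gt0 actx
  (1 + 2 * threshold) (1 + 2 * alpha)); [lra|lra|..].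
- move=> a ar aNr; have [i [air nbr]] := ring_interface ar aNr.
  have [S SI S_eq] := weak i; exists i, S; split=> //.
  rewrite ring_advantage eqxx S_eq; move: nbr lt_alpha thr_ge.
  rewrite /threshold /payoff /actx.
  by case: (a (ordS i)); case: (a (ord_pred i)) => //= _; case: ifP => _; lra.
- exists (Ordinal (ltnW (ltnW n_ge3))).
  set i := Ordinal _; have [S SI S_eq] := weak i; exists S; split=> //.
  rewrite ring_advantage eqxx S_eq !ffunE /threshold /payoff /actx/=.
  by case: ifP => _; lra.
- move=> i S _; rewrite ring_advantage !ffunE /payoff /actx/=.
  by case: ifP => _; lra.
Qed.

Lemma ring_susceptible (alpha : R) : alpha < threshold ->
  susceptible (@ring_graph n) k alpha.
Proof.
move=> lt_alpha.
have thr_le : threshold <= 1 by rewrite /threshold; case: ifP; lra.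
have thr_ge : 1 / 2 <= threshold by rewrite /threshold; case: ifP; lra.
have infl i : exists2 S, S \in influence_sets 'I_n k & i \in S.
  by apply: influence_set_containing; rewrite card_ord.
(* The loss [1 + 2 * alpha] of an influenced agent leaving [all_x] may be negative, while the
   criterion asks for [0 <= E]; hence the maximum. *)
apply: (@strictly_stable_of_advantages _ _ _ _ _ k_le n_gt0 acty
  (Num.max 0 (1 + 2 * alpha)) (1 + 2 * threshold)).
- by rewrite le_max lexx.
- by rewrite gt_max; apply/andP; split; lra.
- move=> a ar aNr; have [i [air nbr]] := ring_interface ar aNr.
  have [S SI iS] := infl i; exists i, S; split=> //.
  rewrite ring_advantage iS; move: nbr; rewrite /payoff /actx /acty.
  by case: (a (ordS i)); case: (a (ord_pred i)) => //= _; lra.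
- exists (Ordinal (ltnW (ltnW n_ge3))).
  set i := Ordinal _; have [S SI iS] := infl i; exists S; split=> //.
  rewrite ring_advantage iS !ffunE /payoff /actx /acty/= lerNl le_max.
  by apply/orP; right; lra.
- move=> i S; rewrite ring_advantage !ffunE /threshold /payoff /actx /acty/=.
  case: (ltnP k n) => [_ _|k_ge]; first by case: ifP => _; lra.
  have -> : k = #|'I_n| by rewrite card_ord; lia.
  by rewrite influence_sets_full inE => /eqP ->; rewrite inE; lra.
Qed.

(** The two consensus states are distinct, so their masses sum to at most 1 and cannot both tend to
    1. *)
Lemma not_resilient_susceptible (alpha : R) :
  resilient (@ring_graph n) k alpha -> susceptible (@ring_graph n) k alpha -> False.
Proof.
move=> res sus.
pose mu beta := stationary_dist (@ring_graph n) alpha k beta.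
have mass beta : mu beta (all_x 'I_n) + mu beta (all_y 'I_n) <= 1.
  have [mu_ge0 mu1 _] := stationary_distP (@ring_graph n) alpha k_le n_gt0 beta.
  rewrite -[leRHS]mu1 /mu (bigD1 (all_x 'I_n))//= lerD2l.
  rewrite (bigD1 (all_y 'I_n))/=; last first.
    by apply/eqP => /ffunP/(_ (Ordinal (ltnW (ltnW n_ge3)))); rewrite !ffunE.
  by rewrite lerDl sumr_ge0.
have : (1 : R) + 1 <= 1.
  apply: (@ler_cvg_to _ (+oo : set_system R) _ _
    (fun beta => mu beta (all_x 'I_n) + mu beta (all_y 'I_n)) (fun=> 1)).
  - exact: (cvgD res sus).
  - exact: cvg_cst.
  - exact: nearW mass.
lra.
Qed.

(** The resilient values [threshold + eps] bound the infimum from above; any value below [threshold]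
    is susceptible, hence not resilient. *)
Lemma alpha_resil_ring : alpha_resil R (@ring_graph n) k = threshold%:E.
Proof.
apply/eqP; rewrite eq_le; apply/andP; split.
  apply/lee_addgt0Pr => eps eps_gt0; apply: ereal_inf_lbound.
  by exists (threshold + eps) => //; apply: ring_resilient; rewrite ltrDl.
apply: le_ereal_inf_tmp => _ [alpha res <-]; rewrite lee_fin leNgt.
by apply/negP => /ring_susceptible; exact: not_resilient_susceptible.
Qed.

Lemma alpha_sus_ring : alpha_sus R (@ring_graph n) k = threshold%:E.
Proof.
apply/eqP; rewrite eq_le; apply/andP; split.
  apply: ge_ereal_sup => _ [alpha sus <-]; rewrite lee_fin leNgt.
  by apply/negP => /ring_resilient res; exact: not_resilient_susceptible res sus.
apply/lee_subgt0Pr => eps eps_gt0; apply: ereal_sup_ubound.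
exists (threshold - eps); last by rewrite EFinB.
by apply: ring_susceptible; rewrite ltrBlDr ltrDl.
Qed.

End Ring.

Theorem theorem5 (R : realType) (n k : nat) (hn : (3 <= n)%N)
    (hk : (1 <= k <= n)%N) :
  alpha_resil R (@ring_graph n) k = alpha_sus R (@ring_graph n) k /\
  alpha_sus R (@ring_graph n) k =
    (if (k < n)%N then (1 / 2)%:E else 1%:E).
Proof.
rewrite alpha_resil_ring// alpha_sus_ring//; split=> //.
by rewrite /threshold; case: ifP.
Qed.
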